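(* Let $G$ be a connected triangle-free graph with at least two vertices. If $G\in\mathfrak{N}_{c}$, then $W_{c}(G)\leq |V(G)|+\Delta(G)-2$.
   Context: All graphs are finite, undirected, without loops or multiple edges. $\Delta(G)$ is the maximum degree of $G$ and $d_G(v)$ is the degree of the vertex $v$. For a positive integer $t$, an interval cyclic $t$-coloring of $G$ is a proper edge-coloring of $G$ with colors $1,\ldots,t$ such that all $t$ colors are used and, for each vertex $v$, the edges incident to $v$ are colored by $d_{G}(v)$ consecutive colors modulo $t$ (i.e. consecutive in the cyclic order $1,2,\ldots,t,1$). $\mathfrak{N}_{c}$ is the set of graphs having an interval cyclic $t$-coloring for some positive integer $t$. For $G\in\mathfrak{N}_{c}$, $W_{c}(G)$ is the greatest $t$ for which $G$ has an interval cyclic $t$-coloring. *)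

(* Defs.v *)
From mathcomp Require Import all_boot.
From mathcomp Require Import boolp.
Set Implicit Arguments.
Unset Strict Implicit.
Unset Printing Implicit Defensive.

Record sgraph := SGraph {
  vertex :> finType;
  adj : rel vertex;
  adj_sym : symmetric adj;
  adj_irrefl : irreflexive adj }.

Definition degree (G : sgraph) (v : G) : nat := #|[set w | adj v w]|.

Definition max_degree (G : sgraph) : nat := \max_(v : G) degree v.

Definition connected_graph (G : sgraph) : Prop :=
  forall x y : G, connect (@adj G) x y.

Definition triangle_free (G : sgraph) : Prop :=
  forall x y z : G, ~ (adj x y /\ adj y z /\ adj x z).

Definition edges (G : sgraph) : {set {set G}} :=
  [set [set p.1; p.2] | p : G * G & adj p.1 p.2].

(* The color reached from color a after i steps in the cyclic order
   1, 2, ..., t, 1 on the colors 1, ..., t. *)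
Definition cyclic_color (t a i : nat) : nat := ((a.-1 + i) %% t).+1.

(* Only the values of c on the edges of G are relevant. *)
Definition proper_edge_coloring (G : sgraph) (c : {set G} -> nat) : Prop :=
  forall e f, e \in edges G -> f \in edges G ->
    e != f -> e :&: f != set0 -> c e <> c f.

(* The i < degree v colors in the last clause are pairwise distinct:
   properness forces degree v <= t. *)
Definition interval_cyclic_coloring (G : sgraph) (t : nat)
    (c : {set G} -> nat) : Prop :=
  [/\ proper_edge_coloring c,
      forall e, e \in edges G -> 1 <= c e <= t,
      forall k, 1 <= k <= t -> exists2 e, e \in edges G & c e = k
    & forall v : G, exists2 a, 1 <= a <= t &
        forall k, (exists e, [/\ e \in edges G, v \in e & c e = k]) <->
                  (exists2 i, i < degree v & k = cyclic_color t a i)].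

Definition interval_cyclic_colorable (G : sgraph) (t : nat) : Prop :=
  0 < t /\ exists c : {set G} -> nat, interval_cyclic_coloring t c.

Definition in_Nc (G : sgraph) : Prop :=
  exists t, interval_cyclic_colorable G t.

Lemma colorable_ex (G : sgraph) :
  in_Nc G -> exists t, `[< interval_cyclic_colorable G t >].
Proof. by case=> t Ht; exists t; apply/asboolP. Qed.

Lemma colorable_ub (G : sgraph) (t : nat) :
  `[< interval_cyclic_colorable G t >] -> t <= #|edges G|.
Proof.
move=> /asboolP [_ [c [_ _ surj _]]].
rewrite -[t in t <= _](size_iota 1) cardE -(size_map c).
apply: uniq_leq_size (iota_uniq 1 t) _ => k.
rewrite mem_iota add1n ltnS => /surj [e He <-].
by apply/mapP; exists e => //; rewrite mem_enum.
Qed.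

Definition Wc (G : sgraph) (hG : in_Nc G) : nat :=
  ex_maxn (colorable_ex hG) (@colorable_ub G).

Lemma WcP (G : sgraph) (hG : in_Nc G) :
  interval_cyclic_colorable G (Wc hG) /\
  forall t, interval_cyclic_colorable G t -> t <= Wc hG.
Proof.
rewrite /Wc; case: ex_maxnP => w /asboolP Hw maxw; split=> // t Ht.
by apply: maxw; apply/asboolP.
Qed.

(* Main.v *)
Require Import Defs.
From mathcomp Require Import all_boot.
From mathcomp Require Import all_order ssralg ssrnum ssrint.
From mathcomp Require Import boolp zify.
Import GRing.Theory.

(** Fix an interval cyclic coloring with [t] colors.  The cyclic color interval
    of a vertex can be lifted to an interval of integers, determined up to a
    multiple of [t]; lifting it at one vertex determines a lift at each
    neighbor, through the color of the common edge.  Walks thus live in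
    a covering of the graph, whose points are pairs [(v, x)] of a vertex and the
    height at which its lifted interval starts, and where every edge has an
    integer color.  Along a closed walk of the graph the height changes by
    a multiple of [t], the weight of the walk.

    The main step ([spread], [spread_bound]) bounds the range of integer colors
    met by a geodesic of the covering.  Choose the geodesic greedily: at
    each vertex, step to the neighbor closer to the target that is joined by
    the smallest color.  Each color of the range is assigned to the first vertex
    [v] of the geodesic whose outgoing color is at least as large (the last
    vertex takes the remaining ones); it occurs on an edge at [v], and the
    other end of that edge is chosen.  By the greedy choice, that end is the next
    vertex of the geodesic or no closer to the target than [v].  As there are
    no triangles, different colors thus yield different vertices of the covering,
    all different from the starting one.  If the geodesic is short compared to
    the closed walks of positive weight, these also lie over different vertices
    of the graph, and the range has at most [#|G| - 1] colors.

    If no closed walk has positive weight ([bound_no_closed]), every vertex has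
    a single lift once one of them is fixed, and some geodesic meets a range of
    [t] colors, so [t <= #|G| - 1].  Otherwise ([bound_closed]), a shortest
    closed walk of positive weight with one vertex left out provides the
    geodesic; its weight is at least [t], and the omitted vertex accounts for at
    most [max_degree G - 1] of it, so [t <= #|G| + max_degree G - 2]. *)

Set Implicit Arguments.
Unset Strict Implicit.
Unset Printing Implicit Defensive.

(** * Colorings as positions in the intervals of the vertices *)

(** [cyclic_positions t p a] describes an interval cyclic [t]-coloring
    vertex by vertex: [a v] is the first color of the interval of [v], with
    colors counted from 0, and [p v w] is the position of the edge [vw] in that
    interval, so that the edge has color [a v + p v w] modulo [t].  Only the
    values of [p] on adjacent pairs matter. *)
Record cyclic_positions {G : sgraph} (t : nat) (p : G -> G -> nat)
    (a : G -> nat) : Prop := CyclicPositions {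
  pos_lt : forall v w : G, adj v w -> p v w < degree v;
  pos_onto : forall (v : G) i, i < degree v -> exists2 w, adj v w & p v w = i;
  pos_inj : forall v w1 w2 : G,
    adj v w1 -> adj v w2 -> p v w1 = p v w2 -> w1 = w2;
  pos_mod : forall v w : G, adj v w -> a v + p v w = a w + p w v %[mod t];
  pos_all : forall k, exists v w : G, adj v w /\ a v + p v w = k %[mod t];
  pos_degree : forall v : G, degree v <= t }.

Lemma eqmodz (m n t : nat) : m = n %[mod t] ->
  exists k : int, (m%:Z = n%:Z + k * t%:Z)%R.
Proof.
move=> e; exists ((m %/ t)%:Z - (n %/ t)%:Z)%R.
have := divn_eq m t; have := divn_eq n t; rewrite e; nia.
Qed.

Lemma multiple_eq0 (t : nat) (k : int) :
  (- t%:Z < k * t%:Z)%R -> (k * t%:Z <= 0)%R -> (k * t%:Z = 0)%R.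
Proof. by move=> H1 H2; have [] : (k <= -1 \/ k = 0 \/ k >= 1)%R; nia. Qed.

(** * Weighted walks *)

Section Walks.
Context {G : sgraph} (p : G -> G -> nat).
Local Open Scope ring_scope.

(** If the interval of [v] is lifted to integers starting at height [x], then
    the edge [vw] has the integer color [x + p v w], and the interval of [w]
    containing that color starts at height [x + shift v w]. *)
Definition shift (v w : G) : int := (p v w)%:Z - (p w v)%:Z.

(** [walk n v u z]: there is a walk of length [n] from [v] to [u] along which
    the shifts add up to [z], the weight of the walk. *)
Fixpoint walk (n : nat) (v u : G) (z : int) : Prop :=
  if n is m.+1 then exists2 v', adj v v' & walk m v' u (z - shift v v')
  else v = u /\ z = 0.

Lemma shiftE v w : shift v w = (p v w)%:Z - (p w v)%:Z.
Proof. by []. Qed.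

Lemma shiftC v w : shift w v = - shift v w.
Proof. by rewrite !shiftE; lia. Qed.

Lemma walk_step n v w u z :
  adj v w -> walk n w u z -> walk n.+1 v u (shift v w + z).
Proof.
move=> vw H; exists w => //.
by have -> : shift v w + z - shift v w = z by lia.
Qed.

Lemma walk_edge v w : adj v w -> walk 1 v w (shift v w).
Proof. by move=> vw; exists w => //=; split=> //; lia. Qed.

Lemma walk_cat m n v w u y z :
  walk m v w y -> walk n w u z -> walk (m + n) v u (y + z).
Proof.
elim: m v y => [|m IH] v y /=; first by case=> -> -> H; rewrite add0n add0r.
case=> v' vv' H1 H2; exists v' => //.
have -> : y + z - shift v v' = (y - shift v v') + z by lia.
exact: IH.
Qed.

Lemma walk_rev n v u z : walk n v u z -> walk n u v (- z).
Proof.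
elim: n v z => [|n IH] v z /=; first by case=> -> ->; rewrite oppr0.
case=> v' vv' /IH H.
have {}vv' : adj v' v by rewrite adj_sym.
have := walk_cat H (walk_edge vv').
rewrite addn1 [shift v' v]shiftC.
by have -> : - (z - shift v v') + - shift v v' = - z by lia.
Qed.

Lemma walk_last n v u z : walk n.+1 v u z ->
  exists w, adj w u /\ walk n v w (z - shift w u).
Proof.
move=> /walk_rev [w uw /walk_rev H]; exists w; split; first by rewrite adj_sym.
by move: H; rewrite [shift u w]shiftC; congr walk; lia.
Qed.

Lemma connect_walk v u : connect (@adj G) v u -> exists n z, walk n v u z.
Proof.
case/connectP=> s; elim: s v => [|w s IH] v /=.
  by move=> _ ->; exists 0%N, 0.
case/andP=> vw sp /(IH _ sp) [n [z H]].
by exists n.+1, (shift v w + z); apply: walk_step.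
Qed.

End Walks.

(** * The colors along a geodesic *)

Section Spread.
Context {G : sgraph} {t : nat} {p : G -> G -> nat} {a : G -> nat}.
Hypothesis Gtf : triangle_free G.
Hypothesis pos : cyclic_positions t p a.
Local Open Scope ring_scope.
Local Notation shift := (shift p).
Local Notation walk := (walk p).

Lemma walk_mod n v u z : walk n v u z ->
  exists k : int, (a u)%:Z + k * t%:Z = (a v)%:Z + z.
Proof.
elim: n v z => [|n IH] v z /=; first by case=> -> ->; exists 0; lia.
case=> w /(pos_mod pos)/eqmodz [k kE] /IH [l lE].
by exists (l + k); move: lE; rewrite mulrDl !shiftE; lia.
Qed.

(** Around a closed walk the lift returns to the same residue. *)
Lemma closed_walk_mod n v z : walk n v v z -> exists k : int, z = k * t%:Z.
Proof. by case/walk_mod=> k kE; exists k; lia. Qed.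

Lemma closed_walk_eq0 n v z : walk n v v z -> - t%:Z < z -> z <= 0 -> z = 0.
Proof. by case/closed_walk_mod=> k ->; apply: multiple_eq0. Qed.

(** The neighbors [w] of [v] such that the color of [vw] is greater than [b] and
    at most [c], when the interval of [v] starts at height [x]. *)
Definition arc v (x b c : int) : {set G} :=
  [set w | adj v w & (b < x + (p v w)%:Z) && (x + (p v w)%:Z <= c)].

Lemma arc_card v (x b c : int) :
  x - 1 <= b -> c <= x + (degree v)%:Z - 1 -> c - b <= #|arc v x b c|%:Z.
Proof.
move=> xb cd; have [?|bc] : c - b <= 0 \/ 0 <= c - b by lia.
  by apply: (@Order.POrderTheory.le_trans _ _ 0).
suff : (absz (c - b)%R <= #|arc v x b c|)%N by lia.
rewrite -[leqLHS](size_iota (absz (b + 1 - x)%R) (absz (c - b)%R)) cardE.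
rewrite -(size_map (p v)).
apply: uniq_leq_size (iota_uniq _ _) _ => k.
rewrite mem_iota => kI.
have /(pos_onto pos) [w vw pk] : (k < degree v)%N by lia.
apply/mapP; exists w => //.
by rewrite mem_enum inE vw pk; lia.
Qed.

(** The invariant satisfied by the vertices [s] chosen in [spread], for a
    start [(v, x)], a target [(u, y)] at distance [D], and the colors above [b].
    Some lift [(s, h)] of [s] is within [D.+1] steps of [(v, x)] and has a color
    above [b] in its interval; and either it is a neighbor of [(v, x)], joined
    to it by a color above [b], or it is not [(v, x)] and not farther than [D]
    from the target. *)
Definition spread_point D v (x b : int) u (y : int) s : Prop :=
  exists h : int,
    [/\ exists2 m, (m <= D.+1)%N & walk m v s (h - x),
        b < h + (degree s)%:Z - 1
      & [/\ adj v s, h = x + shift v s & b < x + (p v s)%:Z] \/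
        (exists2 m, (m <= D)%N & walk m s u (y - h)) /\ ~ (s = v /\ h = x)].

Lemma arc_point D v (x b : int) u (y : int) s :
  adj v s -> b < x + (p v s)%:Z -> spread_point D v x b u y s.
Proof.
move=> vs bs; exists (x + shift v s); split; last by left.
  exists 1%N => //; have -> : x + shift v s - x = shift v s by lia.
  exact: walk_edge.
have sv : adj s v by rewrite adj_sym.
by have := pos_lt pos sv; rewrite !shiftE; lia.
Qed.

(** Let the target [(u, y)] be at distance [D] from [(v, x)].  Then for each
    color [k] with [b < k <= f], where [f] is at most the last color of [u],
    a vertex of [G] can be chosen, with different vertices for different colors.
    The last two hypotheses say that closed walks of positive weight are too long
    to let two lifts of one vertex be chosen; the last one concerns the closed
    walks, possibly one step longer, that begin with an edge [sv] whose color
    at [v] is above [b].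

    By induction on [D]: among the neighbors of [(v, x)] closer to the target,
    take the one, [v'], with the smallest position at [v], and let [b0] be the
    color of [vv'].  The colors up to [b0] are assigned to the other ends of
    the edges at [v] that carry them, and the colors above [b0] are handled from
    [v'].  By the choice of [v'], the new vertices other than [v'] are no closer
    to the target than [v], so they could only be chosen again at [v'], which
    the absence of triangles excludes. *)
Lemma spread D v (x b : int) u (y f : int) :
  x - 1 <= b -> f <= y + (degree u)%:Z - 1 ->
  walk D v u (y - x) ->
  (forall m, (m < D)%N -> ~ walk m v u (y - x)) ->
  (forall m s z, (m <= D.+1)%N -> walk m s s z -> z <= 0) ->
  (forall m s z, adj v s -> b < x + (p v s)%:Z -> (m <= D.+1)%N ->
     walk m v s z -> z + shift s v <= 0) ->
  exists S : {set G}, f - b <= #|S|%:Z /\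
    forall s, s \in S -> spread_point D v x b u y s.
Proof.
move=> xb fd.
elim: D v x b xb => [|D IH] v x b xb vu Dmin closed_le closed_le1.
  case: vu => vu yx; subst u; have {}yx : y = x by lia.
  subst y; exists (arc v x b f); split; first exact: arc_card.
  by move=> s; rewrite inE => /and3P[vs bs _]; apply: arc_point.
pose closer w := adj v w && `[< walk D w u (y - x - shift v w) >].
have [w0 cw0] : exists w, closer w.
  by case: vu => w vw wu; exists w; rewrite /closer vw; apply/asboolP.
case: (@arg_minnP _ w0 closer (p v) cw0) => v' /andP[vv' /asboolP v'u] v'min.
pose x' := x + shift v v'; pose b0 := x + (p v v')%:Z.
pose b' : int := if b < b0 then b0 else b.
have v'v : adj v' v by rewrite adj_sym.
have b0E : b0 = x' + (p v' v)%:Z by rewrite /b0 /x' !shiftE; lia.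
have [bb' b0b'] : b <= b' /\ b0 <= b' by rewrite /b'; case: ifP; lia.
have yx' : y - x' = y - x - shift v v' by rewrite /x'; lia.
have [S' [cardS' S'P]] : exists S' : {set G}, f - b' <= #|S'|%:Z /\
    forall s, s \in S' -> spread_point D v' x' b' u y s.
  apply: IH; first by lia.
  - by rewrite yx'.
  - move=> m mD H; case: (Dmin m.+1 mD).
    by exists v' => //; rewrite -yx'.
  - by move=> m s z mD; apply: closed_le; lia.
  - move=> m s z v's _ mD H.
    have sv' : adj s v' by rewrite adj_sym.
    rewrite addrC; apply: closed_le (walk_step sv' H); lia.
have back s : s \in S' -> spread_point D.+1 v x b u y s.
  move=> /S'P [h [[m mD v's] bh cs]]; exists h; split; last right.
  - exists m.+1 => //; exists v' => //.
    by have -> : h - x - shift v v' = h - x' by rewrite /x'; lia.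
  - by lia.
  case: cs => [[as1 hE bs]|[[k kD su] _]]; split.
  - exists D.+1 => //.
    have -> : y - h = shift s v' + (y - x') by rewrite hE [shift s v']shiftC; lia.
    by apply: walk_step; rewrite 1?adj_sym // yx'.
  - by case=> sv _; subst s; lia.
  - by exists k => //; lia.
  - by case=> sv hx; subst s; apply: (Dmin k); rewrite -?hx //; lia.
have [bb0|b0b] : b < b0 \/ b0 <= b by lia.
  have b'E : b' = b0 by rewrite /b' bb0.
  pose N := arc v x b b0.
  have NP s : s \in N -> [/\ adj v s, b < x + (p v s)%:Z, x + (p v s)%:Z <= b0 &
      s = v' \/ ~ exists2 m, (m <= D)%N & walk m s u (y - x - shift v s)].
    rewrite inE => /and3P[vs bs sb0]; split=> //.
    have [->|sv'] := eqVneq s v'; [by left|right].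
    have [psv'|psv'] : p v s = p v v' \/ (p v s < p v v')%N by lia.
      by rewrite (pos_inj pos vs vv' psv') eqxx in sv'.
    case=> m mD su; have [mD1|mD1] : m = D \/ (m < D)%N by lia.
      subst m; have := v'min s; rewrite /closer vs asboolT //= => /(_ isT); lia.
    by apply: (Dmin m.+1) => //; exists s.
  exists (N :|: S'); split; last first.
    move=> s /setUP[|]; last exact: back.
    by case/NP=> vs bs _ _; apply: arc_point.
  have cN : b0 - b <= #|N|%:Z.
    by apply: arc_card => //; have := pos_lt pos vv'; lia.
  (* It remains to see that no vertex is chosen both at [v] and from [v']: two
     lifts of such a vertex coincide, and then the distances conflict. *)
  suff NS : [disjoint N & S'].
    by have [_] := leq_card_setU N S'; rewrite NS => /eqP ->; lia.
  apply/pred0P=> s /=; apply/negP.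
  case/andP=> [/NP[vs bs sb0 sP] /S'P[h [[m mD v's] bh cs]]].
  have sv : adj s v by rewrite adj_sym.
  have vsw : walk m.+1 v s (h - x).
    exists v' => //.
    by have -> : h - x - shift v v' = h - x' by rewrite /x'; lia.
  (* The edge [sv] followed by the walk from [v] to [s] is a closed walk of
     weight above [-t] and at most 0, hence of weight 0. *)
  have hE : h = x + shift v s.
    have Hc := walk_step sv vsw.
    have le0 : h - x + shift s v <= 0 by apply: closed_le1 vsw => //; lia.
    have ds := pos_degree pos s.
    have : shift s v + (h - x) = 0.
      by apply: closed_walk_eq0 Hc _ _; rewrite !shiftE in le0 *; lia.
    by rewrite [shift s v]shiftC; lia.
  case: cs => [[v's1 h' _]|[[k kD su] sv']].
    case: sP => [sv'|_]; first by rewrite sv' adj_irrefl in v's1.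
    by apply: (Gtf (x := v) (y := v') (z := s)).
  case: sP => [sv1|]; first by apply: sv'; split=> //; rewrite hE sv1.
  apply; exists k => //.
  by have -> : y - x - shift v s = y - h by rewrite hE; lia.
(* Here no color above [b] is at most [b0], so nothing is chosen at [v]. *)
have b'E : b' = b by rewrite /b'; case: ifP => //; lia.
by exists S'; split=> //; rewrite -b'E.
Qed.

(** The vertex [v] itself is never chosen, which gains 1. *)
Lemma spread_bound D v (x b : int) u (y f : int) :
  x - 1 <= b -> f <= y + (degree u)%:Z - 1 ->
  walk D v u (y - x) ->
  (forall m, (m < D)%N -> ~ walk m v u (y - x)) ->
  (forall m s z, (m <= D.+1)%N -> walk m s s z -> z <= 0) ->
  (forall m s z, adj v s -> b < x + (p v s)%:Z -> (m <= D.+1)%N ->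
     walk m v s z -> z + shift s v <= 0) ->
  f - b <= #|G|%:Z - 1.
Proof.
move=> xb fd vu Dmin closed_le closed_le1.
have [S [cardS SP]] := spread xb fd vu Dmin closed_le closed_le1.
suff vS : v \notin S.
  have := subset_leq_card (subsetT (v |: S)).
  by rewrite cardsU1 vS cardsT; lia.
apply/negP=> /SP [h [[m mD vv] bh cs]].
have le0 := closed_le _ _ _ mD vv.
have dv := pos_degree pos v.
have hx : h - x = 0 by apply: closed_walk_eq0 vv _ le0; lia.
by case: cs => [[]|[_ []]]; [rewrite adj_irrefl | split=> //; lia].
Qed.

(** * The two cases *)

(** Without closed walks of positive weight every vertex has a well-defined
    height.  From a lowest vertex [v], of height [h v], a geodesic leads to a
    vertex with an edge whose integer color is congruent to [h v - 1] modulo [t],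
    hence at least [h v - 1 + t]. *)
Lemma bound_no_closed : connected_graph G -> (0 < #|G|)%N ->
  (forall n v z, walk n v v z -> z <= 0) -> t%:Z <= #|G|%:Z - 1.
Proof.
move=> Gconn /card_gt0P[r _] closed_le.
have /choice [h hP] v : exists z n, walk n r v z.
  by have [n [z H]] := connect_walk p (Gconn r v); exists z, n.
have hE v w n z : walk n v w z -> z = h w - h v.
  have [k kP] := hP v; have [l lP] := hP w => H.
  have := closed_le _ _ _ (walk_cat (walk_cat kP H) (walk_rev lP)).
  have := closed_le _ _ _ (walk_cat (walk_cat lP (walk_rev H)) (walk_rev kP)).
  by lia.
have [v vmin] : exists v, forall w, h v <= h w.
  case: (@Order.TotalTheory.arg_minP _ _ _ r predT h) => // v _ H.
  by exists v => w; apply: H.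
(* The color, taken modulo [t], that precedes the first color of [v]. *)
have [k0 k0E] : exists k0 : nat, exists k : int, k0%:Z = (a v)%:Z - 1 + k * t%:Z.
  have t_gt0 : (0 < t)%N.
    have [v1 [w1 [/(pos_lt pos)]]] := pos_all pos 0.
    by have := pos_degree pos v1; lia.
  by exists (a v + t.-1)%N, 1; lia.
have [w [w' [ww' /eqmodz[k kE]]]] := pos_all pos k0.
have hk : exists k : int, h w + (p w w')%:Z = h v - 1 + k * t%:Z.
  have [n [z vw]] := connect_walk p (Gconn v w).
  have [l lE] := walk_mod vw; case: k0E => j jE.
  exists (k + l + j); rewrite (hE _ _ _ _ vw) in lE.
  by rewrite !mulrDl; lia.
have [n [z vw]] := connect_walk p (Gconn v w).
have ex : exists n, `[< walk n v w (h w - h v) >].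
  by exists n; apply/asboolP; rewrite -(hE _ _ _ _ vw).
case: (ex_minnP ex) => D /asboolP vwD Dmin.
have pw := pos_lt pos ww'.
suff : h w + (p w w')%:Z - (h v - 1) <= #|G|%:Z - 1.
  have := vmin w; case: hk => l lE; have [] : l <= 0 \/ 1 <= l by lia.
    by nia.
  by nia.
apply: (@spread_bound D v (h v) (h v - 1) w (h w)) => //; [lia|..].
- by move=> m mD /asboolP/Dmin; lia.
- by move=> m s y _; apply: closed_le.
- move=> m s y vs _ _ H.
  have sv : adj s v by rewrite adj_sym.
  exact: closed_le (walk_cat H (walk_edge p sv)).
Qed.

(** A closed walk of positive weight has weight at least [t].  Take a shortest
    one, through [v], and choose its last step, from [v0] to [v], with
    [p v v0] as large as possible.  The geodesic given to [spread_bound] goes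
    from [v] to the vertex [u] preceding [v0], and the colors counted are those
    from the color of [vv0], excluded, to that of [uv0].  The difference to the
    weight of the closed walk is a difference of positions at [v0], so it is
    at most [max_degree G - 1]. *)
Lemma bound_closed n v z : walk n v v z -> 0 < z ->
  t%:Z <= #|G|%:Z + (max_degree G)%:Z - 2.
Proof.
move=> vvz z_gt0.
pose positive m := `[< exists v z, walk m v v z /\ 0 < z >].
have ex : exists m, positive m by exists n; apply/asboolP; exists v, z.
case: (ex_minnP ex) => L /asboolP [{}v [W [vvW W_gt0]]] Lmin {n z vvz z_gt0 ex}.
have closed_le m s z : (m < L)%N -> walk m s s z -> z <= 0.
  move=> mL H; have [//|z_gt0] : z <= 0 \/ 0 < z by lia.
  by have /Lmin : positive m; [apply/asboolP; exists s, z | lia].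
case: L => [|[|D]] in Lmin vvW closed_le *.
- by case: vvW; lia.
- by case: vvW => w vw [wv _]; rewrite wv adj_irrefl in vw.
pose closing w := adj w v &&
  `[< exists z, walk D.+1 v w z /\ 0 < z + shift w v >].
have [w0 cw0] : exists w, closing w.
  have [w [wv H]] := walk_last vvW; exists w; rewrite /closing wv.
  by apply/asboolP; exists (W - shift w v); split=> //; lia.
case: (@arg_maxnP _ w0 closing (p v) cw0) => v0.
case/andP=> v0v /asboolP[z [vv0 z_gt0]] v0max.
have [u [uv0 vu]] := walk_last vv0.
set y := z - shift u v0 in vu.
have vv1 := walk_cat vv0 (walk_edge p v0v).
suff fb : y + (p u v0)%:Z - (p v v0)%:Z <= #|G|%:Z - 1.
  have dv0 : (degree v0 <= max_degree G)%N by apply: (leq_bigmax v0).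
  have pv := pos_lt pos v0v.
  have [k kE] := closed_walk_mod vv1.
  have : t%:Z <= z + shift v0 v.
    have [] : k <= 0 \/ 1 <= k by lia.
      by nia.
    by nia.
  by move: fb; rewrite /y !shiftE; lia.
apply: (@spread_bound D v 0 (p v v0)%:Z u y); rewrite ?subr0 //.
- by have := pos_lt pos uv0; lia.
- move=> m mD vu'.
  have H := walk_cat (walk_cat vu' (walk_edge p uv0)) (walk_edge p v0v).
  have mL : (m + 1 + 1 < D.+2)%N by lia.
  by have := closed_le _ _ _ mL H; rewrite /y; lia.
move=> m s x vs; rewrite add0r => ps mD vsx.
have sv : adj s v by rewrite adj_sym.
have [//|xs_gt0] : x + shift s v <= 0 \/ 0 < x + shift s v by lia.
have H := walk_cat vsx (walk_edge p sv).
(* If [m] is [D.+1], a shortest closed walk through [v] has its last step coming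
   from [s], against the choice of [v0]. *)
have [mD1|mD1] : m = D.+1 \/ (m < D.+1)%N by lia.
  subst m; have := v0max s; rewrite /closing sv asboolT /= => [/(_ isT)|]; first by lia.
  by exists x.
have mL : (m + 1 < D.+2)%N by lia.
by have := closed_le _ _ _ mL H; lia.
Qed.

End Spread.

(** * Positions from a coloring *)

Section FromColoring.
Context {G : sgraph} {t : nat} {c : {set G} -> nat}.
Hypothesis t_gt0 : 0 < t.
Hypothesis col : interval_cyclic_coloring t c.

Lemma edge_mem (v w : G) : adj v w -> [set v; w] \in edges G.
Proof. by move=> vw; apply/imsetP; exists (v, w); rewrite ?inE. Qed.

Lemma edge_inj (v w1 w2 : G) : adj v w1 -> adj v w2 ->
  c [set v; w1] = c [set v; w2] -> w1 = w2.
Proof.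
case: col => proper _ _ _ vw1 vw2 e; apply/eqP/negPn/negP=> w12.
case: (proper _ _ (edge_mem vw1) (edge_mem vw2)) => //.
  apply: contra w12 => /eqP/setP/(_ w1); rewrite !inE eqxx orbT.
  case/esym/orP=> // /eqP w1v; by rewrite w1v adj_irrefl in vw1.
by apply/set0Pn; exists v; rewrite !inE eqxx.
Qed.

Lemma degree_le_colors (v : G) : degree v <= t.
Proof.
rewrite -[t](size_iota 1) /degree cardE -(size_map (fun w => c [set v; w])).
apply: uniq_leq_size => [|k /mapP[w]].
  rewrite map_inj_in_uniq ?enum_uniq // => w1 w2.
  by rewrite !mem_enum !inE; apply: edge_inj.
rewrite mem_enum inE => vw ->; rewrite mem_iota add1n ltnS.
by case: col => _ + _ _; apply; apply: edge_mem.
Qed.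

Lemma edgeP (e : {set G}) (v : G) : e \in edges G -> v \in e ->
  exists2 w, adj v w & e = [set v; w].
Proof.
case/imsetP=> [[x y]]; rewrite inE /= => xy ->; rewrite !inE.
case/orP=> /eqP ->; first by exists y.
by exists x; [rewrite adj_sym | rewrite setUC].
Qed.

Lemma coloring_positions : exists (p : G -> G -> nat) (a : G -> nat),
  cyclic_positions t p a.
Proof.
case: (col) => proper crange call cint.
have /choice[a aP] (v : G) : exists a, forall k,
    (exists e, [/\ e \in edges G, v \in e & c e = k]) <->
    (exists2 i, i < degree v & k = cyclic_color t a i).
  by have [a _ H] := cint v; exists a.
have /choice[p pP] (vw : G * G) : exists i, adj vw.1 vw.2 ->
    i < degree vw.1 /\ c [set vw.1; vw.2] = cyclic_color t (a vw.1) i.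
  case: vw => v w /=; have [vw|nvw] := boolP (adj v w); last by exists 0.
  have [i iv ci] : exists2 i,
      i < degree v & c [set v; w] = cyclic_color t (a v) i.
    by apply/aP; exists [set v; w]; rewrite edge_mem // !inE eqxx.
  by exists i.
exists (fun v w => p (v, w)), (fun v => (a v).-1); split.
- by move=> v w /(pP (v, w))[].
- move=> v i iv.
  have [_] := aP v (cyclic_color t (a v) i).
  case/(_ (ex_intro2 _ _ i iv erefl))=> e [eG ve ce].
  have [w vw eE] := edgeP eG ve; exists w => //.
  have [pv] := pP (v, w) vw; rewrite /= -eE ce => -[/eqP].
  rewrite eqn_modDl !modn_small; last 2 first.
  + exact: leq_trans pv (degree_le_colors v).
  + exact: leq_trans iv (degree_le_colors v).
  by move/eqP.
- move=> v w1 w2 vw1 vw2 pe; apply: (edge_inj vw1 vw2).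
  by rewrite (pP (v, w1) vw1).2 (pP (v, w2) vw2).2 /= pe.
- move=> v w vw; have wv : adj w v by rewrite adj_sym.
  have := (pP (v, w) vw).2; have := (pP (w, v) wv).2.
  by rewrite /= setUC => -> [].
- move=> k; have [e eG ce] : exists2 e, e \in edges G & c e = (k %% t).+1.
    by apply: call; rewrite /= ltn_mod.
  case/imsetP: (eG) => -[v w]; rewrite inE /= => vw eE.
  exists v, w; split=> //.
  by have := (pP (v, w) vw).2; rewrite /= -eE ce => -[].
- exact: degree_le_colors.
Qed.

End FromColoring.

Theorem theorem10 (G : sgraph)
  (Gconn : connected_graph G)
  (Gtf : triangle_free G)
  (Gge2 : 2 <= #|G|)
  (GNc : in_Nc G) :
  Wc GNc <= #|G| + max_degree G - 2.
Proof.
case: (WcP GNc) => -[t_gt0 [c col]] _; set t := Wc GNc in t_gt0 col *.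
have [p [a pos]] := coloring_positions t_gt0 col.
have [closed_le|] := pselect (forall n v z, walk p n v v z -> (z <= 0)%R).
  have := bound_no_closed Gtf pos Gconn (ltnW Gge2) closed_le.
  have [v [w [vw _]]] := pos_all pos 0.
  have dv : degree v <= max_degree G by apply: leq_bigmax.
  by have := pos_lt pos vw; lia.
move/existsNP=> [n /existsNP[v /existsNP[z /not_implyP[vvz]]]] /negP z_gt0.
by have := bound_closed Gtf pos vvz; lia.
Qed.
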